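(* Let $\varepsilon\in(0,1]$ be fixed, $M\in(0,\alpha|\Omega|)$ (here $\Omega=(0,1)$, $|\Omega|=1$), and let $$\rho_i^{\varepsilon,\infty}=(U_\varepsilon')^{-1}(C_\varepsilon^\Delta-V(x_i)),\quad i\in I,$$ where $C_\varepsilon^\Delta$ is uniquely determined by the mass condition $\Delta x\sum_i(U_\varepsilon')^{-1}(C_\varepsilon^\Delta-V(x_i))=M$. Then: (i) $\rho^{\varepsilon,\infty}$ is the unique constant-in-time solution of $(P_\varepsilon^\Delta)$ in $\mathcal A_{\Delta,+}$ of mass $M$. (ii) It is the global attractor, i.e. for any $\rho^0\in\mathcal A_{\Delta,+}$ of mass $M$, $(J_\varepsilon^\Delta)^n\rho^0\to\rho^{\varepsilon,\infty}$ in $\mathbb R^{|I|}$ as $n\to\infty$. (iii) Let $C_\varepsilon$ be the constant, uniquely determined by $\int_\Omega(U_\varepsilon')^{-1}(C_\varepsilon-V(x))\,dx=M$, in the continuous steady state $\widehat\rho^{(\varepsilon)}=(U_\varepsilon')^{-1}(C_\varepsilon-V)$. Then $|C_\varepsilon^\Delta-C_\varepsilon|\le\mathsf C(\varepsilon)\,\Delta x$, with $\mathsf C(\varepsilon)$ independent of $\Delta x$.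
   Context: Setting. $\Omega=(0,1)$. Standing assumptions: (1) $\alpha\in(0,\infty)$, $\mathrm m\in C([0,\alpha])\cap C^1((0,\alpha))$, $\mathrm m(0)=\mathrm m(\alpha)=0$, $\mathrm m>0$ on $(0,\alpha)$; (2) $V\in C^2([0,1])$, $V\ge0$; (3) $U\in W^{1,1}((0,\alpha))\cap C^3((0,\alpha))$, $U''\ge0$, and $s_0\in(0,\alpha)$ is a fixed point with $U''(s_0)>0$; (4) $\mathrm m U''\in L^1(0,\alpha)$ and, with $\Phi(s):=\int_{s_0}^s\mathrm m(\tau)U''(\tau)\,d\tau$, one has $\Phi(0)<\Phi(s)<\Phi(\alpha)$ for $s\in(0,\alpha)$ and $$\sup_{s\in[0,\alpha]}\left|\tfrac{(\Phi(\alpha)-\Phi(s))\Phi(s)}{\Phi'(s)}\right|+\left|\tfrac{(\Phi(s)-\Phi(0))\Phi(s)}{\Phi'(s)}\right|<\infty .$$ Regularisation, $\varepsilon\in(0,1]$. $\kappa(\varepsilon)>0$ with $\kappa(\varepsilon)\to0$ as $\varepsilon\to0$. $\Phi_\varepsilon\in C^3([0,\alpha])$ satisfies $g_\varepsilon\le\Phi_\varepsilon'\le(1+\varepsilon)g_\varepsilon$, where $g_\varepsilon(s)=\min(\Phi'(s),\kappa(\varepsilon)^{-1})+\varepsilon$, $\Phi_\varepsilon(s_0)=0$, and $\Phi_\varepsilon\to\Phi$ in $C^2_{loc}((0,\alpha))$. $\mathrm m_\varepsilon\in C^1([0,\alpha])$ satisfies $\mathrm m_\varepsilon(0)=\mathrm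 m_\varepsilon(\alpha)=0$, $\mathrm m_\varepsilon>0$ in $(0,\alpha)$, $|\mathrm m_\varepsilon'|>1$ near $0$ and $\alpha$. $U_\varepsilon\in C^{3,1}((0,\alpha))$ is given by $U_\varepsilon''=\Phi_\varepsilon'/\mathrm m_\varepsilon$, $U_\varepsilon(\alpha/2)=U(\alpha/2)$, $U_\varepsilon'(\alpha/2)=U'(\alpha/2)$; consequently $U_\varepsilon':(0,\alpha)\to\mathbb R$ is a strictly increasing bijection. Moreover $\mathrm m_\varepsilon\to\mathrm m$ pointwise, $\sup_{\varepsilon\in(0,1)}\|U_\varepsilon'\|_{L^1((0,\alpha))}<\infty$, and $(\varepsilon,s)\mapsto\mathrm m_\varepsilon(s)$ (with $\mathrm m_0=\mathrm m$) belongs to $C([0,1]\times[0,\alpha])\cap C^\infty_{loc}((0,1]\times[0,\alpha])$. Decomposition of the mobility (assumed): $\mathrm m_\varepsilon=\mathrm m_\varepsilon^{(1)}\mathrm m_\varepsilon^{(2)}$ with $\mathrm m_\varepsilon^{(j)}:[0,\alpha]\to[0,\infty)$ Lipschitz continuous, $\mathrm m_\varepsilon^{(1)}$ non-decreasing, $\mathrm m_\varepsilon^{(2)}$ non-increasing. Scheme $(P^\Delta_\varepsilon)$. Let $N\in\mathbb N$, $I=\{1,\dots,N\}$, $\Delta x=1/N$, $\Delta t>0$, $x_i=(i-\frac12)\Delta x$, $\Delta=(\Delta t,\Delta x)$. Given $\rho^n$, $\rho^{n+1}$ solves, for $i\in I$, $$\frac{\rho_i^{n+1}-\rho_i^n}{\Delta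 t}=-\frac{F_{i+\frac12}(\rho^{n+1})-F_{i-\frac12}(\rho^{n+1})}{\Delta x},$$ $$F_{i+\frac12}(\rho)=\mathrm m_\varepsilon^{(1)}(\rho_i)\mathrm m_\varepsilon^{(2)}(\rho_{i+1})(v_{i+\frac12}(\rho))^++\mathrm m_\varepsilon^{(1)}(\rho_{i+1})\mathrm m_\varepsilon^{(2)}(\rho_i)(v_{i+\frac12}(\rho))^-,$$ $$v_{i+\frac12}(\rho)=-\frac{\xi_{i+1}(\rho)-\xi_i(\rho)}{\Delta x},\quad \xi_i(\rho)=U_\varepsilon'(\rho_i)+V(x_i),\quad F_{\frac12}=F_{N+\frac12}=0,$$ with $u^+=\max(u,0)$, $u^-=\min(u,0)$. $\mathcal A_{\Delta,+}=\{\rho\in\mathbb R^{|I|}:0<\rho_i<\alpha\}$. For $\rho^0\in\mathcal A_{\Delta,+}$ the step has a unique solution $J_\varepsilon^\Delta\rho^0:=\rho^1\in\mathcal A_{\Delta,+}$. The mass of $\rho\in\mathbb R^{|I|}$ is $\Delta x\sum_i\rho_i$. A constant-in-time solution is a $\rho$ with $J^\Delta_\varepsilon\rho=\rho$. *)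

(* Defs.v *)
From mathcomp Require Import all_boot all_order all_algebra.
From mathcomp Require Import all_classical all_reals all_analysis.

Set Implicit Arguments.
Unset Strict Implicit.
Unset Printing Implicit Defensive.

Import Order.TTheory GRing.Theory Num.Theory.
Import numFieldNormedType.Exports.

Local Open Scope classical_set_scope.
Local Open Scope ring_scope.

(* In ring_scope these notations otherwise denote derivatives of polynomials. *)
Local Notation "f ^` ()" := (derive1 f) : ring_scope.
Local Notation "f ^` ( n )" := (derive1n n f) : ring_scope.

(* Functions on an interval are represented by functions R -> R whose values
   outside that interval are irrelevant: every notion below only looks at the
   interval concerned. *)

Section Regularity.
Context {R : realType}.
Implicit Types (a b e s x : R) (f g phi : R -> R) (i j k n : nat).

Definition Ck_oo k a b f : Prop :=
  forall x, a < x < b ->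
    (forall j, (j < k)%N -> derivable f^`(j) x 1) /\
    (forall j, (j <= k)%N -> {for x, continuous f^`(j)}).

(* C^k up to the boundary: f is continuous on [a, b] and its derivatives on
   ]a, b[ extend continuously to [a, b]. *)
Definition Ck_cc k a b f : Prop :=
  [/\ {within `[a, b], continuous f},
      Ck_oo k a b f &
      forall j, (j <= k)%N ->
        exists g, {within `[a, b], continuous g} /\
                  {in `]a, b[, f^`(j) =1 g}].

(* C^{k,1} on an open interval: as for C^k, the condition on the last
   derivative is local, i.e. it is Lipschitz on compact subintervals. *)
Definition Ck1_oo k a b f : Prop :=
  Ck_oo k a b f /\
  forall c d, a < c -> d < b -> [lipschitz f^`(k) x | x in `[c, d]].

Definition test_function a b phi : Prop :=
  (forall n x, derivable phi^`(n) x 1) /\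
  (exists c d, [/\ a < c, d < b & forall x, ~~ (c <= x <= d) -> phi x = 0]).

Definition W11_oo a b f : Prop :=
  (@lebesgue_measure R).-integrable `]a, b[ (EFin \o f) /\
  exists g, (@lebesgue_measure R).-integrable `]a, b[ (EFin \o g) /\
    forall phi, test_function a b phi ->
      \int[@lebesgue_measure R]_(x in `]a, b[) (f x * phi^`() x) =
      - \int[@lebesgue_measure R]_(x in `]a, b[) (g x * phi x).

(* Joint C^oo regularity on ]0, 1] x [0, a], up to the boundary: D i j is the
   continuous extension of the partial derivative of order i in the first
   variable and j in the second one. *)
Definition Coo_joint a (f : R -> R -> R) : Prop :=
  exists D : nat -> nat -> R -> R -> R,
    [/\ forall e s, 0 < e <= 1 -> 0 <= s <= a -> D 0%N 0%N e s = f e s,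
        forall i j,
          {within [set p : R * R | 0 < p.1 <= 1 /\ 0 <= p.2 <= a],
             continuous (fun p => D i j p.1 p.2)} &
        forall i j e s, 0 < e < 1 -> 0 < s < a ->
          is_derive e 1 (fun e' => D i j e' s) (D i.+1 j e s) /\
          is_derive s 1 (D i j e) (D i j.+1 e s)].

(* f_ e --> f in C^k_loc(]a, b[) as e --> 0+. *)
Definition cvg_Ck_loc k a b (f_ : R -> R -> R) f : Prop :=
  forall c d j (delta : R), a < c -> d < b -> (j <= k)%N -> 0 < delta ->
    \forall e \near 0^'+, forall x, c <= x <= d ->
      `|(f_ e)^`(j) x - f^`(j) x| < delta.

End Regularity.

Section Setting.
Context {R : realType}.
Local Notation mu := (@lebesgue_measure R).
Implicit Types (alpha e s x : R) (m V U : R -> R).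

(* The oriented integral of m U'' from s0 to s; one of the two intervals is
   empty. *)
Definition Phi (s0 : R) m U (s : R) : R :=
  \int[mu]_(t in `]s0, s[) (m t * U^`(2) t) -
  \int[mu]_(t in `]s, s0[) (m t * U^`(2) t).

(* In st_bound the supremum is taken over the open interval, where Phi is
   differentiable, and the division by Phi' s is made meaningful by requiring
   Phi' s != 0 (a finite supremum excludes Phi' s = 0, which in Rocq would
   make the quotient 0). *)
Record standing_assumptions alpha (s0 : R) m V U : Prop := {
  st_alpha : 0 < alpha;
  st_m_cont : {within `[0, alpha], continuous m};
  st_m_C1 : Ck_oo 1 0 alpha m;
  st_m0 : m 0 = 0;
  st_malpha : m alpha = 0;
  st_m_gt0 : forall s, 0 < s < alpha -> 0 < m s;
  st_V_C2 : Ck_cc 2 0 1 V;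
  st_V_ge0 : forall x, 0 <= x <= 1 -> 0 <= V x;
  st_U_W11 : W11_oo 0 alpha U;
  st_U_C3 : Ck_oo 3 0 alpha U;
  st_U_convex : forall s, 0 < s < alpha -> 0 <= U^`(2) s;
  st_s0 : 0 < s0 < alpha;
  st_U_s0 : 0 < U^`(2) s0;
  st_mU_L1 : mu.-integrable `]0, alpha[ (EFin \o (fun s => m s * U^`(2) s));
  st_Phi_lt : forall s, 0 < s < alpha ->
    Phi s0 m U 0 < Phi s0 m U s < Phi s0 m U alpha;
  st_bound : exists K : R, forall s, 0 < s < alpha ->
    let P := Phi s0 m U in
    P^`() s != 0 /\
    `|(P alpha - P s) * P s / P^`() s| + `|(P s - P 0) * P s / P^`() s| <= K
}.

Definition g_trunc (s0 : R) m U (kappa : R -> R) (e s : R) : R :=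
  Num.min ((Phi s0 m U)^`() s) (kappa e)^-1 + e.

Record regularisation alpha (s0 : R) m U
    (kappa : R -> R) (Phi_ m_ U_ : R -> R -> R) : Prop := {
  rg_kappa_gt0 : forall e, 0 < e <= 1 -> 0 < kappa e;
  rg_kappa_cvg : kappa e @[e --> 0^'+] --> 0;
  rg_Phi_C3 : forall e, 0 < e <= 1 -> Ck_cc 3 0 alpha (Phi_ e);
  rg_Phi_bounds : forall e s, 0 < e <= 1 -> 0 < s < alpha ->
    g_trunc s0 m U kappa e s <= (Phi_ e)^`() s
      <= (1 + e) * g_trunc s0 m U kappa e s;
  rg_Phi_s0 : forall e, 0 < e <= 1 -> Phi_ e s0 = 0;
  rg_Phi_cvg : cvg_Ck_loc 2 0 alpha Phi_ (Phi s0 m U);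
  rg_m_C1 : forall e, 0 < e <= 1 -> Ck_cc 1 0 alpha (m_ e);
  rg_m_0 : forall e, 0 < e <= 1 -> m_ e 0 = 0;
  rg_m_alpha : forall e, 0 < e <= 1 -> m_ e alpha = 0;
  rg_m_gt0 : forall e s, 0 < e <= 1 -> 0 < s < alpha -> 0 < m_ e s;
  rg_m_near0 : forall e, 0 < e <= 1 ->
    \forall s \near 0^'+, 1 < `|(m_ e)^`() s|;
  rg_m_nearalpha : forall e, 0 < e <= 1 ->
    \forall s \near alpha^'-, 1 < `|(m_ e)^`() s|;
  rg_U_C31 : forall e, 0 < e <= 1 -> Ck1_oo 3 0 alpha (U_ e);
  rg_U_second : forall e s, 0 < e <= 1 -> 0 < s < alpha ->
    (U_ e)^`(2) s = (Phi_ e)^`() s / m_ e s;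
  rg_U_mid : forall e, 0 < e <= 1 -> U_ e (alpha / 2) = U (alpha / 2);
  rg_U_mid' : forall e, 0 < e <= 1 ->
    (U_ e)^`() (alpha / 2) = U^`() (alpha / 2);
  rg_m_cvg : forall s, 0 <= s <= alpha -> m_ e s @[e --> 0^'+] --> m s;
  rg_U_L1 : (ereal_sup [set \int[mu]_(s in `]0%R, alpha[) `|(U_ e)^`() s|%:E
                       | e in `]0%R, 1%R[] < +oo)%E;
  rg_m_at0 : forall s, 0 <= s <= alpha -> m_ 0 s = m s;
  rg_m_joint_cont :
    {within [set p : R * R | 0 <= p.1 <= 1 /\ 0 <= p.2 <= alpha],
       continuous (fun p => m_ p.1 p.2)};
  rg_m_joint_Coo : Coo_joint alpha m_
}.

Record mobility_decomposition alpha (m_ m1_ m2_ : R -> R -> R) : Prop := {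
  md_mul : forall e s, 0 < e <= 1 -> 0 <= s <= alpha ->
    m_ e s = m1_ e s * m2_ e s;
  md_ge0_1 : forall e s, 0 < e <= 1 -> 0 <= s <= alpha -> 0 <= m1_ e s;
  md_ge0_2 : forall e s, 0 < e <= 1 -> 0 <= s <= alpha -> 0 <= m2_ e s;
  md_lip_1 : forall e, 0 < e <= 1 -> [lipschitz (m1_ e) s | s in `[0, alpha]];
  md_lip_2 : forall e, 0 < e <= 1 -> [lipschitz (m2_ e) s | s in `[0, alpha]];
  md_mono_1 : forall e, 0 < e <= 1 ->
    {in `[0, alpha] &, {homo m1_ e : s t / s <= t}};
  md_mono_2 : forall e, 0 < e <= 1 ->
    {in `[0, alpha] &, {homo m2_ e : s t / s <= t >-> t <= s}}
}.

End Setting.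

(* In this section U, m1 and m2 stand for the regularised U_e, m_e^(1) and
   m_e^(2) at a fixed e. The cell i in {1, ..., N} is the ordinal i - 1. *)
Section Scheme.
Context {R : realType}.
Variables (alpha : R) (V U m1 m2 : R -> R) (N : nat).
Implicit Types (rho : 'rV[R]_N) (k : nat) (dt : R).

Definition dx : R := N%:R^-1.

Definition xmid k : R := (k%:R + 2^-1) * dx.

Definition cell rho k : R := oapp (rho 0) 0 (insub k : option 'I_N).

Definition xi rho k : R := U^`() (cell rho k) + V (xmid k).

(* Velocity and flux through the face x = k dx, which separates the cells of
   ordinals k - 1 and k (v_{k + 1/2} and F_{k + 1/2} for cells numbered from
   1); the flux vanishes at the boundary faces k = 0 and k = N. *)
Definition velocity rho k : R := - ((xi rho k - xi rho k.-1) / dx).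

Definition flux rho k : R :=
  if (0 < k < N)%N then
    m1 (cell rho k.-1) * m2 (cell rho k) * Num.max (velocity rho k) 0 +
    m1 (cell rho k) * m2 (cell rho k.-1) * Num.min (velocity rho k) 0
  else 0.

Definition scheme_step dt rho rho' : Prop :=
  forall i : 'I_N,
    (rho' 0 i - rho 0 i) / dt = - ((flux rho' i.+1 - flux rho' i) / dx).

Definition admissible : set 'rV[R]_N :=
  [set rho | forall i, 0 < rho 0 i < alpha].

Definition mass rho : R := dx * \sum_(i < N) rho 0 i.

(* J maps every admissible rho to the unique admissible solution of the step
   starting from rho. *)
Definition solution_map dt (J : 'rV[R]_N -> 'rV[R]_N) : Prop :=
  forall rho rho', admissible rho ->
    (admissible rho' /\ scheme_step dt rho rho') <-> J rho = rho'.

End Scheme.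

Section SteadyStates.
Context {R : realType}.
Variables (alpha : R) (V U : R -> R).
Implicit Types (C : R).

Definition inv_U' : R -> R := 'pinv_(fun=> 0) `]0, alpha[ U^`().

Definition steady_state (N : nat) C : 'rV[R]_N :=
  \row_(i < N) inv_U' (C - V (xmid N i)).

Definition discrete_mass (N : nat) C : R := mass (steady_state N C).

Definition continuous_mass C : R :=
  \int[@lebesgue_measure R]_(x in `]0, 1[) inv_U' (C - V x).

End SteadyStates.

(* Main.v *)
Require Import Defs.
From mathcomp Require Import all_boot all_order all_algebra.
From mathcomp Require Import all_classical all_reals all_analysis.
From mathcomp Require Import ring lra.

(** The chemical potential u = U_e' has derivative Phi_e' / m_e. Since
    Phi_e' >= e and since m_e vanishes at least linearly at both ends of
    ]0, alpha[, u' is bounded below by a multiple of 1 / s and of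
    1 / (alpha - s). Hence u diverges logarithmically at both ends and is onto R
    ([coercive_of_derive]); its inverse phi is globally Lipschitz, and has a
    positive slope on compact sets ([inv_U'_lip], [inv_U'_slope]).

    The discrete and the continuous masses are both averages over ]0, 1[ of the
    profile x |-> phi (C - V x), so they inherit these two-sided slope bounds as
    functions of C ([mean_of]). The intermediate value theorem gives existence
    and uniqueness of the constants ([mean_root]), which moreover lie in a range
    that does not depend on the number of cells ([mean_root_range]). The two
    masses differ by the error of the midpoint rule, which is O(dx) as the
    profile is Lipschitz ([midpoint_rule]); dividing it by the uniform lower
    slope bounds the difference of the constants ([mass_constants_close]).

    For the scheme, the flux through a face is the velocity times a positive
    mobility ([flux_upwind]). A stationary state has zero fluxes, hence zero
    velocities, hence a constant potential xi = u (rho_i) + V (x_i), and the mass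
    fixes the constant ([steady_state_charact]). For the convergence:
    - at a cell where the new potential xi is maximal no flux points inwards, so
      the density does not increase there; thus the maximum of xi does not
      increase and its minimum does not decrease ([xi_max_principle],
      [xi_min_principle]). The trajectory therefore stays in a compact subset of
      the admissible set, on which the mobilities are bounded below
      ([trajectory_confined]);
    - the energy sum_i (U (rho_i) + V (x_i) rho_i) is convex, is minimal at the
      steady state among densities of the same mass, and drops at each step by at
      least dt * sum_k flux_k * velocity_k ([energy_dissipation]). So the
      dissipation tends to 0, and with it all the velocities;
    - small velocities make xi almost constant, and as the mass is conserved this
      constant has to be close to that of the steady state ([xi_close]).
      Applying phi gives the convergence of the densities ([trajectory_cvg]). *)

Set Implicit Arguments.
Unset Strict Implicit.
Unset Printing Implicit Defensive.

Import Order.TTheory GRing.Theory Num.Theory.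
Import numFieldNormedType.Exports.

Local Open Scope classical_set_scope.
Local Open Scope ring_scope.

Local Notation "f ^` ()" := (derive1 f) : ring_scope.
Local Notation "f ^` ( n )" := (derive1n n f) : ring_scope.

(** * Mean value estimates *)

Lemma mvt_open {R : realType} (f : R -> R) (a b p q : R) :
  (forall s, a < s < b -> derivable f s 1) -> a < p -> p < q -> q < b ->
  exists2 x, p < x < q & f q - f p = f^`() x * (q - p).
Proof.
move=> df ap pq qb.
have [||x] := @MVT R f f^`() p q pq.
- move=> x; rewrite in_itv/= => /andP[x1 x2]; rewrite derive1E.
  by apply/derivableP/df; lra.
- apply: derivable_within_continuous => x; rewrite in_itv/= => /andP[x1 x2].
  by apply: df; lra.
- by rewrite in_itv/= => x12 ->; exists x.
Qed.

Lemma Ck_cc_lipschitz {R : realType} (k : nat) (f : R -> R) (a b : R) :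
  (0 < k)%N -> a < b -> Ck_cc k a b f ->
  exists2 L, 0 < L & forall x y, a <= x <= b -> a <= y <= b ->
    `|f x - f y| <= L * `|x - y|.
Proof.
move=> k0 ab [cf dfk /(_ 1%N k0)[g [cg fg]]].
have df s : a < s < b -> derivable f s 1.
  by move=> /dfk[/(_ 0%N k0)].
(* The derivative is bounded because it extends continuously to [a, b]. *)
have [z _ zmax] := EVT_max (ltW ab) cg.
have [w _ wmin] := EVT_min (ltW ab) cg.
exists (1 + `|g z| + `|g w|); first by rewrite ltr_pwDl// ltr_pwDl.
move=> x y xab yab.
wlog xy : x y xab yab / x < y => [H|].
  case: (ltgtP x y) => [/H|/H|->]; [exact| |by rewrite !subrr normr0 mulr0].
  by rewrite distrC (distrC x); apply.
have [||v] := @MVT R f f^`() x y xy.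
- move=> v; rewrite in_itv/= => /andP[v1 v2]; rewrite derive1E.
  by apply/derivableP/df; lra.
- apply: continuous_subspaceW cf => v /=; rewrite !in_itv/=; lra.
rewrite in_itv/= => vxy E; rewrite distrC (distrC x) E normrM ler_wpM2r//.
rewrite -derive1n1 fg ?in_itv/=; last by lra.
have vab : v \in `[a, b] by rewrite in_itv/=; lra.
have := zmax v vab; have := wmin v vab.
have := ler_norm (g z); have := ler_norm (- g w); rewrite normrN.
have := normr_ge0 (g z); have := normr_ge0 (g w).
by rewrite ler_norml; lra.
Qed.

(** * Coercive chemical potentials *)

(** The slope bound and the local Lipschitz bound of u bound the slope of its
    inverse from above, and from below on compact sets; surjectivity makes the
    inverse total. *)
Record coercive_potential {R : realType} (a : R) (u : R -> R) (c : R) : Prop := {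
  cp_gt0 : 0 < c;
  cp_slope : forall s t, 0 < s -> s <= t -> t < a -> c * (t - s) <= u t - u s;
  cp_lip : forall p q, 0 < p -> q < a -> exists2 L, 0 < L &
    forall s t, p <= s -> s <= t -> t <= q -> u t - u s <= L * (t - s);
  cp_surj : forall y, exists2 s, 0 < s < a & u s = y
}.

(** A function with slope at least k / s near 0 drops by at least k / 2 each
    time s is halved; this is the logarithmic divergence at 0. *)
Lemma unbounded_below {R : realType} (u : R -> R) (a k : R) : 0 < a -> 0 < k ->
  (forall s t, 0 < s -> s < t -> t < a -> k * (t - s) <= t * (u t - u s)) ->
  forall y, exists2 s, 0 < s < a & u s <= y.
Proof.
move=> a0 k0 H y.
pose s n := a / 2 ^+ n.+1.
have s0 n : 0 < s n by rewrite divr_gt0// exprn_gt0.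
have sS n : s n = 2 * s n.+1.
  by rewrite /s [2 ^+ n.+2]exprS invfM mulrCA mulVKf ?pnatr_eq0.
have sa n : s n < a.
  elim: n => [|n IH]; first by rewrite /s expr1; lra.
  by have := s0 n.+1; have := sS n; lra.
have us n : u (s n) <= u (s 0%N) - n%:R * (k / 2).
  elim: n => [|n IH]; first by rewrite mul0r subr0.
  apply: (@le_trans _ _ (u (s n) - k / 2)); last first.
    by rewrite -[n.+1%:R]natr1; lra.
  have lt : s n.+1 < s n by have := s0 n.+1; have := sS n; lra.
  have := H _ _ (s0 _) lt (sa n); rewrite (sS n) => le.
  rewrite -(ler_pM2l (s0 n.+1)); lra.
pose n := (Num.truncn ((u (s 0%N) - y) / (k / 2))).+1.
exists (s n); first by rewrite s0 sa.
apply: le_trans (us n) _.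
have : (u (s 0%N) - y) / (k / 2) <= n%:R by rewrite ltW// truncnS_gt.
by rewrite ler_pdivrMr ?divr_gt0//; lra.
Qed.

(** Surjectivity comes from the divergence at both ends; the divergence at a is
    the one at 0 for the reflected function t |-> - u (a - t). *)
Lemma coercive_of_derive {R : realType} (u : R -> R) (a k : R) :
  0 < a -> 0 < k -> (forall s, 0 < s < a -> derivable u s 1) ->
  (forall s, 0 < s < a -> {for s, continuous u^`()}) ->
  (forall s, 0 < s < a -> k <= s * u^`() s /\ k <= (a - s) * u^`() s) ->
  coercive_potential a u (k / a).
Proof.
move=> a0 k0 du cu ku.
have u'0 s : 0 < s < a -> 0 < u^`() s.
  move=> /[dup] /ku[ks _] /andP[s0 _].
  by rewrite -(pmulr_rgt0 _ s0); exact: lt_le_trans ks.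
have lo s t : 0 < s -> s < t -> t < a -> k * (t - s) <= t * (u t - u s).
  move=> s0 st ta; have [x /andP[sx xt] ->] := mvt_open du s0 st ta.
  have x0a : 0 < x < a by lra.
  rewrite mulrA ler_wpM2r ?subr_ge0 ?(ltW st)//.
  apply: le_trans (ku x x0a).1 _.
  by rewrite ler_wpM2r ?(ltW (u'0 _ x0a))// ltW.
have hi s t : 0 < s -> s < t -> t < a -> k * (t - s) <= (a - s) * (u t - u s).
  move=> s0 st ta; have [x /andP[sx xt] ->] := mvt_open du s0 st ta.
  have x0a : 0 < x < a by lra.
  rewrite mulrA ler_wpM2r ?subr_ge0 ?(ltW st)//.
  apply: le_trans (ku x x0a).2 _.
  by rewrite ler_wpM2r ?(ltW (u'0 _ x0a))//; lra.
have slope s t : 0 < s -> s <= t -> t < a -> k / a * (t - s) <= u t - u s.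
  move=> s0; rewrite le_eqVlt => /predU1P[->|st] ta.
    by rewrite !subrr mulr0.
  rewrite mulrAC ler_pdivrMr// mulrC [_ * a]mulrC.
  have up : 0 <= u t - u s.
    rewrite -(pmulr_rge0 _ (lt_trans s0 st)); apply: le_trans (lo s t s0 st ta).
    by rewrite mulr_ge0 ?ltW// subr_gt0.
  rewrite mulrC; apply: le_trans (lo s t s0 st ta) _.
  by rewrite ler_wpM2r// ltW.
split => //; first by rewrite divr_gt0.
- move=> p q p0 qa; have [qp|pq] := ltP q p.
    by exists 1 => // s t ps st tq; exfalso; lra.
  have cpq : {within `[p, q], continuous u^`()}.
    apply: continuous_in_subspaceT => s; rewrite inE/= in_itv/= => /andP[ps sq].
    by apply: cu; lra.
  have [z zpq zmax] := EVT_max pq cpq.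
  have z0a : 0 < z < a by move: zpq; rewrite in_itv/=; lra.
  exists (u^`() z); first exact: u'0.
  move=> s t ps; rewrite le_eqVlt => /predU1P[->|st] tq.
    by rewrite !subrr mulr0.
  have [x /andP[sx xt] ->] :=
    mvt_open du (lt_le_trans p0 ps) st (le_lt_trans tq qa).
  rewrite ler_wpM2r ?subr_ge0 ?(ltW st)// zmax// in_itv/=; lra.
- move=> y.
  have [s sa sy] := unbounded_below a0 k0 lo y.
  have [|t ta ty] := @unbounded_below R (fun t => - u (a - t)) a k a0 k0 _ (- y).
    by move=> p q p0 pq qa; have := @hi (a - q) (a - p); lra.
  have t'a : 0 < a - t < a by lra.
  rewrite lerN2 in ty.
  have st : s <= a - t.
    rewrite leNgt; apply/negP => ts.
    have /andP[t1 t2] := t'a; have /andP[s1 s2] := sa.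
    have := slope _ _ t1 (ltW ts) s2.
    have : 0 < k / a * (s - (a - t)) by rewrite mulr_gt0 ?divr_gt0// subr_gt0.
    lra.
  have cst : {within `[s, a - t], continuous u}.
    apply: derivable_within_continuous => x; rewrite in_itv/= => ?.
    by apply: du; lra.
  have [|x xst <-] := @IVT R u s (a - t) y st cst.
    by rewrite ge_min le_max sy ty orbT.
  by exists x => //; move: xst; rewrite in_itv/=; lra.
Qed.

(** * The inverse of the potential *)

Section Inverse.
Context {R : realType} {a c : R} {U : R -> R}.
Hypothesis cpU : coercive_potential a U^`() c.
Local Notation phi := (inv_U' a U).

Lemma cp_inj : {in `]0, a[%classic &, injective U^`()}.
Proof.
have H s t : 0 < s -> s < t -> t < a -> U^`() s = U^`() t -> False.
  move=> s0 st ta e; have := cp_slope cpU s0 (ltW st) ta.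
  by rewrite e subrr leNgt mulr_gt0 ?(cp_gt0 cpU)// subr_gt0.
move=> s t; rewrite !inE/= !in_itv/= => /andP[s0 sa] /andP[t0 ta] e.
by case: (ltgtP s t) => // [st|ts]; exfalso; [apply: (H s t)|apply: (H t s)].
Qed.

Lemma inv_U'K y : U^`() (phi y) = y.
Proof.
apply: pinvK; rewrite inE/=; have [s sa <-] := cp_surj cpU y.
by exists s => //=; rewrite in_itv.
Qed.

Lemma U'K s : 0 < s < a -> phi (U^`() s) = s.
Proof.
move=> sa; apply: (@pinvKV _ _ (fun=> 0) _ _ cp_inj s).
by rewrite inE/= in_itv.
Qed.

Lemma inv_U'_itv y : 0 < phi y < a.
Proof. by have [s sa <-] := cp_surj cpU y; rewrite U'K. Qed.

Lemma inv_U'_lt y z : y < z -> phi y < phi z.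
Proof.
move=> yz; rewrite ltNge; apply/negP => zy.
have /andP[p1 p2] := inv_U'_itv y; have /andP[q1 q2] := inv_U'_itv z.
have := cp_slope cpU q1 zy p2; rewrite !inv_U'K => H.
have : 0 <= c * (phi y - phi z).
  by rewrite mulr_ge0 ?(ltW (cp_gt0 cpU))// subr_ge0.
lra.
Qed.

Lemma inv_U'_le y z : y <= z -> phi y <= phi z.
Proof. by rewrite le_eqVlt => /predU1P[->//|/inv_U'_lt/ltW]. Qed.

Lemma inv_U'_lip y z : y <= z -> phi z - phi y <= c^-1 * (z - y).
Proof.
move=> /inv_U'_le yz; have /andP[p1 p2] := inv_U'_itv y.
have /andP[q1 q2] := inv_U'_itv z.
have := cp_slope cpU p1 yz q2; rewrite !inv_U'K.
by rewrite mulrC -ler_pdivlMr ?(cp_gt0 cpU)// [_ / c]mulrC.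
Qed.

Lemma inv_U'_lip_norm y z : `|phi z - phi y| <= c^-1 * `|z - y|.
Proof.
wlog yz : y z / y <= z => [H|].
  by case/orP: (le_total y z) => /H//; rewrite distrC (distrC y).
by rewrite !ger0_norm ?subr_ge0 ?inv_U'_le// inv_U'_lip.
Qed.

(** A Lipschitz bound for U' on the compact interval [phi p, phi q] becomes a
    lower slope bound for its inverse phi. *)
Lemma inv_U'_slope p q : exists2 k, 0 < k &
  forall y z, p <= y -> y <= z -> z <= q -> k * (z - y) <= phi z - phi y.
Proof.
have /andP[p1 p2] := inv_U'_itv p; have /andP[q1 q2] := inv_U'_itv q.
have [L L0 HL] := cp_lip cpU p1 q2; exists L^-1; rewrite ?invr_gt0//.
move=> y z py yz zq; rewrite mulrC ler_pdivrMr// [_ * L]mulrC.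
by have := HL _ _ (inv_U'_le py) (inv_U'_le yz) (inv_U'_le zq); rewrite !inv_U'K.
Qed.

End Inverse.

(** * Averages of steady profiles *)

(** D C is an average of the profile phi (C - V x) over ]0, 1[, described only
    through the bounds that averages inherit from the averaged function; the
    discrete mass and the continuous mass are both of this kind. *)
Definition mean_of {R : realType} (a : R) (U V D : R -> R) : Prop :=
  let phi := inv_U' a U in
  (forall C r r', (forall x, 0 < x < 1 -> r <= phi (C - V x) <= r') ->
      r <= D C <= r') /\
  (forall C C' r r',
    (forall x, 0 < x < 1 -> r <= phi (C' - V x) - phi (C - V x) <= r') ->
      r <= D C' - D C <= r').

Section Mean.
Context {R : realType} {a c B : R} {U V D : R -> R}.
Hypothesis cpU : coercive_potential a U^`() c.
Hypothesis V_le : forall x, 0 < x < 1 -> `|V x| <= B.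
Hypothesis meanD : mean_of a U V D.
Local Notation phi := (inv_U' a U).

Lemma mean_bounds C : phi (C - B) <= D C <= phi (C + B).
Proof.
apply: meanD.1 => x /V_le; rewrite ler_norml => /andP[V1 V2].
by rewrite !(inv_U'_le cpU)//; lra.
Qed.

Lemma mean_lip C C' : C <= C' -> 0 <= D C' - D C <= c^-1 * (C' - C).
Proof.
move=> CC'; apply: meanD.2 => x x01.
rewrite subr_ge0 (inv_U'_le cpU)/= ?lerD2r//.
have -> : C' - C = (C' - V x) - (C - V x) by ring.
by rewrite (inv_U'_lip cpU)// lerD2r.
Qed.

Lemma mean_slope p q k :
  (forall y z, p - B <= y -> y <= z -> z <= q + B ->
    k * (z - y) <= phi z - phi y) ->
  forall C C', p <= C -> C <= C' -> C' <= q -> k * (C' - C) <= D C' - D C.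
Proof.
move=> H C C' pC CC' C'q.
(* a is an upper bound since phi takes its values in ]0, a[. *)
suff /andP[//] : k * (C' - C) <= D C' - D C <= a.
apply: meanD.2 => x /V_le; rewrite ler_norml => /andP[V1 V2].
have /andP[p1 p2] := inv_U'_itv cpU (C - V x).
have /andP[q1 q2] := inv_U'_itv cpU (C' - V x).
apply/andP; split; last by lra.
have -> : C' - C = (C' - V x) - (C - V x) by ring.
by apply: H; lra.
Qed.

(** The constant is localised independently of the average D: this is what makes
    the bounds for the discrete masses uniform in the number of cells. *)
Lemma mean_root_range M C : 0 < M < a -> D C = M ->
  U^`() M - B <= C <= U^`() M + B.
Proof.
move=> Ma DC; have := mean_bounds C; rewrite DC => /andP[M1 M2].
rewrite -!(rwP andP); split; rewrite leNgt; apply/negP => H.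
  suff : phi (C + B) < M by rewrite ltNge M2.
  by rewrite -[ltRHS](U'K cpU Ma) (inv_U'_lt cpU)//; lra.
suff : M < phi (C - B) by rewrite ltNge M1.
by rewrite -[ltLHS](U'K cpU Ma) (inv_U'_lt cpU)//; lra.
Qed.

Lemma mean_lt C C' : C < C' -> D C < D C'.
Proof.
move=> CC'; have [k k0 Hk] := inv_U'_slope cpU (C - B) (C' + B).
rewrite -subr_gt0; have := mean_slope Hk (lexx C) (ltW CC') (lexx C').
by apply: lt_le_trans; rewrite mulr_gt0 ?subr_gt0.
Qed.

Lemma mean_continuous : continuous D.
Proof.
move=> C; apply/cvgrPdist_le => d d0; near=> C'.
have : `|D C - D C'| <= c^-1 * `|C - C'|.
  case/orP: (le_total C C') => CC'; have /andP[D1 D2] := mean_lip CC'.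
    by rewrite distrC ger0_norm// distrC ger0_norm ?subr_ge0.
  by rewrite ger0_norm// ger0_norm ?subr_ge0.
move/le_trans; apply; rewrite mulrC ler_pdivrMr ?(cp_gt0 cpU)//.
near: C'; apply: cvgr_dist_le; first exact: cvg_id.
by rewrite mulr_gt0 ?(cp_gt0 cpU).
Unshelve. all: by end_near. Qed.

Lemma mean_root M : 0 < M < a -> exists! C, D C = M.
Proof.
move=> Ma.
have B0 : 0 <= B by apply: le_trans (V_le (x := 2^-1) _) => //; lra.
have [|||C _ DC] := @IVT _ D (U^`() M - B) (U^`() M + B) M.
- by lra.
- exact/continuous_subspaceT/mean_continuous.
- have /andP[_ H1] := mean_bounds (U^`() M - B).
  have /andP[H2 _] := mean_bounds (U^`() M + B).
  rewrite ge_min le_max; move: H1 H2; rewrite addrK subrK (U'K cpU Ma).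
  move=> -> ->.
  by rewrite orbT.
exists C; split => // C' DC'; case: (ltgtP C C') => // /mean_lt; rewrite DC DC'.
  by rewrite ltxx.
by rewrite ltxx.
Qed.

End Mean.
(** * The midpoint rule *)

Section Quadrature.
Context {R : realType}.
Local Notation mu := (@lebesgue_measure R).

Lemma lipschitz_within_continuous (A : set R) (f : R -> R) (L : R) :
  (forall x y, A x -> A y -> `|f x - f y| <= L * `|x - y|) ->
  {within A, continuous f}.
Proof.
move=> fL; apply/subspace_continuousP => x Ax; apply/cvgrPdist_le => e e0.
have L1 : 0 < `|L| + 1 by rewrite ltr_wpDl.
rewrite near_withinE; near=> y => Ay.
apply: le_trans (fL _ _ Ax Ay) _.
apply: (@le_trans _ _ ((`|L| + 1) * `|x - y|)).
  by apply: ler_wpM2r => //; rewrite (le_trans (ler_norm L))// lerDl.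
rewrite mulrC -ler_pdivlMr//.
near: y; apply: cvgr_dist_le; first exact: cvg_id.
by rewrite divr_gt0.
Unshelve. all: by end_near. Qed.

Lemma midpoint_cell (f : R -> R) (L p q x : R) : p < q -> p <= x <= q ->
  (forall y z, p <= y <= q -> p <= z <= q -> `|f y - f z| <= L * `|y - z|) ->
  `|(q - p) * f x - \int[mu]_(y in `]p, q]) f y| <= L * (q - p) ^+ 2.
Proof.
move=> pq /andP[px xq] fL.
have L0 : 0 <= L.
  rewrite -(@pmulr_lge0 _ `|p - q|) ?normr_gt0 ?subr_eq0 ?lt_eqF//.
  by apply: le_trans (fL p q _ _); rewrite ?lexx ?(ltW pq).
have If : mu.-integrable `[p, q] (EFin \o f).
  apply: continuous_compact_integrable; first exact: segment_compact.
  apply: (lipschitz_within_continuous (L := L)) => y z /=.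
  by rewrite !in_itv/=; exact: fL.
have {}If : mu.-integrable `]p, q] (EFin \o f).
  by apply: integrableS If => //; apply: subset_itvr; rewrite bnd_simp.
have Ic (r : R) : mu.-integrable `]p, q] (EFin \o cst r).
  apply: (@integrableS _ _ _ mu `[p, q]) => //.
    by apply: subset_itvr; rewrite bnd_simp.
  apply: continuous_compact_integrable; first exact: segment_compact.
  exact/continuous_subspaceT/cst_continuous.
have Vc (r : R) : \int[mu]_(y in `]p, q]) (cst r y) = r * (q - p).
  by rewrite Rintegral_cst//= lebesgue_measure_itv/= lte_fin pq -EFinD.
have lo : (f x - L * (q - p)) * (q - p) <= \int[mu]_(y in `]p, q]) f y.
  rewrite -Vc; apply: le_Rintegral => // y /=; rewrite in_itv/= => /andP[py yq].
  have := fL x y; rewrite px xq (ltW py) yq => /(_ isT isT).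
  have : L * `|x - y| <= L * (q - p) by rewrite ler_wpM2l// ler_norml; lra.
  by rewrite ler_norml; lra.
have hi : \int[mu]_(y in `]p, q]) f y <= (f x + L * (q - p)) * (q - p).
  rewrite -Vc; apply: le_Rintegral => // y /=; rewrite in_itv/= => /andP[py yq].
  have := fL x y; rewrite px xq (ltW py) yq => /(_ isT isT).
  have : L * `|x - y| <= L * (q - p) by rewrite ler_wpM2l// ler_norml; lra.
  by rewrite ler_norml; lra.
set I := Rintegral _ _ _ in lo hi *; move: I lo hi => I lo hi; clear - lo hi.
by rewrite ler_norml; lra.
Qed.

Lemma dx_gt0 N : (0 < N)%N -> 0 < dx N :> R.
Proof. by move=> N0; rewrite invr_gt0 ltr0n. Qed.

Lemma dxN N : (0 < N)%N -> N%:R * dx N = 1 :> R.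
Proof. by move=> N0; rewrite mulfV// pnatr_eq0 -lt0n. Qed.

Lemma dx_le1 N k : (k <= N)%N -> k%:R * dx N <= 1 :> R.
Proof.
case: N => [|N] kN.
  by move: kN; rewrite leqn0 => /eqP ->; rewrite mul0r.
by rewrite -[leRHS](dxN (ltn0Sn N)) ler_wpM2r ?ler_nat// ltW ?dx_gt0.
Qed.

Lemma xmid_cell N k : (0 < N)%N ->
  k%:R * dx N < (xmid N k : R) < k.+1%:R * dx N.
Proof.
move=> N0; have d0 : 0 < dx N :> R := dx_gt0 N0.
by rewrite /xmid !ltr_pM2r// -[k.+1%:R]natr1; lra.
Qed.

Lemma xmid_itv N k : (k < N)%N -> 0 < (xmid N k : R) < 1.
Proof.
move=> kN; have N0 : (0 < N)%N by case: N kN.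
have /andP[x1 x2] := xmid_cell k N0.
rewrite (le_lt_trans _ x1) ?mulr_ge0 ?(ltW (dx_gt0 N0))//=.
by rewrite (lt_le_trans x2)// dx_le1.
Qed.

(** The error is summed cell by cell: each of the cells to the left of the
    abscissa k dx contributes at most L * dx ^ 2. *)
Lemma midpoint_rule (f : R -> R) (L : R) N : (0 < N)%N ->
  (forall x y, 0 <= x <= 1 -> 0 <= y <= 1 -> `|f x - f y| <= L * `|x - y|) ->
  `|dx N * \sum_(i < N) f (xmid N i) - \int[mu]_(x in `]0, 1[) f x|
    <= L * dx N.
Proof.
move=> N0 fL; have d0 : 0 < dx N :> R := dx_gt0 N0.
have If : mu.-integrable `[0, 1] (EFin \o f).
  apply: continuous_compact_integrable; first exact: segment_compact.
  apply: (lipschitz_within_continuous (L := L)) => y z /=.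
  by rewrite !in_itv/=; exact: fL.
have I0 : mu.-integrable `]0, 1[ (EFin \o f).
  by apply: integrableS If => //; apply: subset_itv; rewrite bnd_simp.
have Ik k : (k <= N)%N -> mu.-integrable `]0, k%:R * dx N] (EFin \o f).
  move=> kN; apply: integrableS If => //.
  by apply: subset_itv; rewrite bnd_simp ?dx_le1.
suff H k : (k <= N)%N ->
    `|dx N * \sum_(i < k) f (xmid N i) - \int[mu]_(x in `]0, k%:R * dx N]) f x|
    <= k%:R * (L * dx N ^+ 2).
  have := H N (leqnn N); rewrite dxN// (Rintegral_itv_bndo_bndc I0).
  move/le_trans; apply.
  by rewrite expr2 !mulrA -[N%:R * L]mulrC -[L * _ * _]mulrA dxN// mulr1.
elim: k => [_|k IH kN].
  by rewrite big_ord0 !mul0r mulr0 set_itvoc0 Rintegral_set0 subrr normr0.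
have kk1 : k%:R * dx N < k.+1%:R * dx N :> R by rewrite ltr_pM2r// ltr_nat.
have k1 : k.+1%:R * dx N <= 1 :> R := dx_le1 kN.
have kp : 0 <= k%:R * dx N :> R by rewrite mulr_ge0// ltW.
have := Rintegral_itvB (x := k%:R * dx N) (Ik _ kN).
rewrite !bnd_simp => /(_ kp (ltW kk1)) E.
have -> : \int[mu]_(x in `]0, k.+1%:R * dx N]) f x =
   \int[mu]_(x in `]0, k%:R * dx N]) f x +
   \int[mu]_(x in `](k%:R * dx N), k.+1%:R * dx N]) f x by rewrite -E; ring.
rewrite big_ord_recr/= mulrDr opprD addrACA.
apply: le_trans (ler_normD _ _) _; rewrite -[k.+1%:R in leRHS]natr1 mulrDl mul1r.
apply: lerD; first by apply: IH; exact: ltnW.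
have e : k.+1%:R * dx N - k%:R * dx N = dx N :> R.
  by rewrite -[k.+1%:R]natr1; ring.
have xk : k%:R * dx N <= (xmid N k : R) <= k.+1%:R * dx N.
  by have /andP[x1 x2] := xmid_cell k N0; rewrite !ltW.
have := midpoint_cell (f := f) (L := L) kk1 xk; rewrite e; apply.
by move=> y z /andP[y1 y2] /andP[z1 z2]; apply: fL; lra.
Qed.
End Quadrature.

(** * The constants of the steady states *)

Section MassMeans.
Context {R : realType} {a c B L : R} {U V : R -> R}.
Hypothesis cpU : coercive_potential a U^`() c.
Hypothesis V_lip : forall x y, 0 <= x <= 1 -> 0 <= y <= 1 ->
  `|V x - V y| <= L * `|x - y|.
Local Notation phi := (inv_U' a U).
Local Notation mu := (@lebesgue_measure R).

Lemma steady_profile_lip C x y : 0 <= x <= 1 -> 0 <= y <= 1 ->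
  `|phi (C - V x) - phi (C - V y)| <= c^-1 * L * `|x - y|.
Proof.
move=> x01 y01; apply: le_trans (inv_U'_lip_norm cpU _ _) _.
have -> : C - V x - (C - V y) = - (V x - V y) by ring.
by rewrite normrN -mulrA ler_wpM2l ?V_lip// invr_ge0 ltW ?(cp_gt0 cpU).
Qed.

Lemma discrete_massE N C :
  discrete_mass a V U N C = dx N * \sum_(i < N) phi (C - V (xmid N i)).
Proof. by congr (_ * _); apply: eq_bigr => i _; rewrite mxE. Qed.

Lemma sum_mean N (f : 'I_N -> R) r r' : (0 < N)%N ->
  (forall i, r <= f i <= r') -> r <= dx N * \sum_(i < N) f i <= r'.
Proof.
move=> N0 fr; have d0 : 0 < dx N :> R := dx_gt0 N0.
have cst (k : R) : dx N * \sum_(i < N) k = k.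
  by rewrite sumr_const card_ord -mulr_natl mulrA [_ * N%:R]mulrC dxN// mul1r.
rewrite -[X in X <= _](cst r) -[X in _ && (_ <= X)](cst r').
rewrite !ler_pM2l// !ler_sum// => i _.
  by have /andP[] := fr i.
by have /andP[] := fr i.
Qed.

Lemma discrete_mass_mean N : (0 < N)%N ->
  mean_of a U V (discrete_mass a V U N).
Proof.
move=> N0; split=> [C r r' H|C C' r r' H]; rewrite !discrete_massE.
  by apply: sum_mean => // i; apply: H; exact: xmid_itv.
by rewrite -mulrBr -sumrB; apply: sum_mean => // i; apply: H; exact: xmid_itv.
Qed.

Lemma steady_profile_integrable C :
  mu.-integrable `]0, 1[ (EFin \o (fun x => phi (C - V x))).
Proof.
have H : mu.-integrable `[0, 1] (EFin \o (fun x => phi (C - V x))).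
  apply: continuous_compact_integrable; first exact: segment_compact.
  apply: (lipschitz_within_continuous (L := c^-1 * L)) => y z /=.
  by rewrite !in_itv/=; exact: steady_profile_lip.
by apply: integrableS H => //; apply: subset_itv; rewrite bnd_simp.
Qed.

Lemma continuous_mass_mean : mean_of a U V (continuous_mass a V U).
Proof.
have cst (r : R) : r = \int[mu]_(x in `]0, 1[) (fun=> r) x.
  rewrite Rintegral_cst//= lebesgue_measure_itv/= lte_fin ltr01 oppr0 adde0.
  by rewrite mulr1.
have icst (r : R) : mu.-integrable `]0, 1[ (EFin \o (fun=> r)).
  apply: (@integrableS _ _ _ mu `[0, 1]) => //.
    by apply: subset_itv; rewrite bnd_simp.
  apply: continuous_compact_integrable; first exact: segment_compact.
  exact/continuous_subspaceT/cst_continuous.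
have int_le (f : R -> R) r r' : mu.-integrable `]0, 1[ (EFin \o f) ->
    (forall x, 0 < x < 1 -> r <= f x <= r') ->
    r <= \int[mu]_(x in `]0, 1[) f x <= r'.
  move=> If H; apply/andP; split.
    rewrite [leLHS]cst; apply: le_Rintegral => // x /=; rewrite in_itv/=.
    by move=> /H /andP[].
  rewrite [leRHS]cst; apply: le_Rintegral => // x /=; rewrite in_itv/=.
  by move=> /H /andP[].
have IC := steady_profile_integrable.
split=> [C r r' H|C C' r r' H]; rewrite /continuous_mass; first exact: int_le.
rewrite -RintegralB//; apply: int_le => //.
exact: integrableB (IC C') (IC C).
Qed.

(** With D the discrete mass, D CD = M is the continuous mass of C. So
    |D CD - D C| is a quadrature error, and it dominates |CD - C| by the lower
    slope of D. *)
Lemma mass_constants_close M : 0 < M < a ->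
  (forall x, 0 < x < 1 -> `|V x| <= B) ->
  exists K : R, forall (N : nat) (CD C : R), (0 < N)%N ->
    discrete_mass a V U N CD = M -> continuous_mass a V U C = M ->
    `|CD - C| <= K * dx N.
Proof.
move=> Ma VB.
(* Both constants lie in [lo, hi], so that one slope k serves all N. *)
pose lo := U^`() M - B; pose hi := U^`() M + B.
have [k k0 Hk] := inv_U'_slope cpU (lo - B) (hi + B).
exists (k^-1 * (c^-1 * L)) => N CD C N0 HCD HC.
have md := discrete_mass_mean N0.
have /andP[d1 d2] := mean_root_range cpU VB md Ma HCD.
have /andP[c1 c2] := mean_root_range cpU VB continuous_mass_mean Ma HC.
have Q := midpoint_rule N0 (@steady_profile_lip C).
rewrite -discrete_massE -/(continuous_mass a V U C) HC -HCD in Q.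
have S := mean_slope cpU VB md Hk.
rewrite -mulrA mulrC ler_pdivlMr//; apply: le_trans Q.
rewrite mulrC; case/orP: (le_total CD C) => CC.
  have := S _ _ d1 CC c2; rewrite distrC ger0_norm ?subr_ge0//.
  by move/le_trans; apply; exact: ler_norm.
have := S _ _ c1 CC d2; rewrite ger0_norm ?subr_ge0//.
by move/le_trans; apply; rewrite distrC; exact: ler_norm.
Qed.
End MassMeans.

(** * Fluxes and the maximum principle *)

Section Scheme.
Context {R : realType} {a c B dt M : R} {U V m1 m2 : R -> R} {N : nat}.
Hypothesis cpU : coercive_potential a U^`() c.
Hypothesis U_der : forall s, 0 < s < a -> derivable U s 1.
Hypothesis m1_gt0 : forall s, 0 < s < a -> 0 < m1 s.
Hypothesis m2_gt0 : forall s, 0 < s < a -> 0 < m2 s.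
Hypothesis m1_mono : forall s t, 0 < s -> s <= t -> t < a -> m1 s <= m1 t.
Hypothesis m2_mono : forall s t, 0 < s -> s <= t -> t < a -> m2 t <= m2 s.
Hypothesis N0 : (0 < N)%N.
Hypothesis dt0 : 0 < dt.
Local Notation phi := (inv_U' a U).
Local Notation xi := (xi V U).
Local Notation velocity := (velocity V U).
Local Notation flux := (flux V U m1 m2).
Local Notation step := (scheme_step V U m1 m2 dt).
Local Notation admissible := (@admissible R a N).
Implicit Types rho : 'rV[R]_N.

Let d0 : 0 < dx N :> R := dx_gt0 N0.

Lemma cellE rho (i : 'I_N) : cell rho i = rho 0 i.
Proof. by rewrite /cell valK. Qed.

Lemma flux0 rho : flux rho 0 = 0. Proof. by []. Qed.

Lemma fluxN rho : flux rho N = 0.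
Proof. by rewrite /Defs.flux ltnn andbF. Qed.

Lemma velocityE rho k : xi rho k - xi rho k.-1 = - (velocity rho k * dx N).
Proof. by rewrite /Defs.velocity mulNr opprK divfK// gt_eqF. Qed.

(** Upwinding only selects which of the two adjacent cells feeds which mobility
    factor. *)
Lemma flux_upwind rho k : (0 < k < N)%N -> exists i j : 'I_N,
  flux rho k = m1 (rho 0 i) * m2 (rho 0 j) * velocity rho k.
Proof.
move=> kN; have /andP[k0 k1] := kN.
have k2 : (k.-1 < N)%N by apply/leq_ltn_trans/k1/leq_pred.
pose i := Ordinal k1; pose j := Ordinal k2.
rewrite /Defs.flux kN (cellE rho i : cell rho k = _).
rewrite (cellE rho j : cell rho k.-1 = _).
case: (lerP 0 (velocity rho k)) => v0; [exists j, i|exists i, j].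
  by rewrite mulr0 addr0.
by rewrite mulr0 add0r.
Qed.

Lemma flux_velocity rho k p q : (0 < k < N)%N ->
  0 < p -> q < a -> (forall i : 'I_N, p <= rho 0 i <= q) ->
  m1 p * m2 q * velocity rho k ^+ 2 <= flux rho k * velocity rho k.
Proof.
move=> kN p0 qa pq; have [i [j ->]] := flux_upwind rho kN.
rewrite -[leRHS]mulrA -expr2 ler_wpM2r ?sqr_ge0//.
have /andP[pi iq] := pq i; have /andP[pj jq] := pq j.
apply: ler_pM.
- by apply/ltW/m1_gt0; rewrite p0/=; lra.
- by apply/ltW/m2_gt0; lra.
- by apply: m1_mono; lra.
- by apply: m2_mono; lra.
Qed.

Lemma flux_sign rho k : admissible rho ->
  exists2 w, 0 <= w & flux rho k = w * velocity rho k.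
Proof.
move=> ad; case: (boolP (0 < k < N)%N) => kN; last first.
  by exists 0; rewrite // mul0r /Defs.flux (negbTE kN).
have [i [j ->]] := flux_upwind rho kN; eexists; last by [].
by rewrite mulr_ge0 ?ltW ?m1_gt0 ?m2_gt0.
Qed.

Lemma flux_eq0 rho k : admissible rho -> (0 < k < N)%N -> flux rho k = 0 ->
  velocity rho k = 0.
Proof.
move=> ad kN; have [i [j ->]] := flux_upwind rho kN => /eqP.
by rewrite mulf_eq0 gt_eqF ?mulr_gt0 ?m1_gt0 ?m2_gt0//= => /eqP.
Qed.

Lemma step_eq rho rho' (i : 'I_N) : step rho rho' ->
  rho' 0 i - rho 0 i = - (dt / dx N * (flux rho' i.+1 - flux rho' i)).
Proof.
move=> /(_ i) H; have := congr1 ( *%R^~ dt) H.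
by rewrite divfK ?gt_eqF// => ->; ring.
Qed.

Lemma mass_step rho rho' : step rho rho' -> mass rho' = mass rho.
Proof.
move=> st; rewrite /mass; congr (_ * _); apply/eqP; rewrite -subr_eq0 -sumrB.
rewrite (eq_bigr _ (fun i _ => step_eq i st)) sumrN -mulr_sumr.
rewrite -(big_mkord xpredT (fun i => flux rho' i.+1 - flux rho' i)).
by rewrite telescope_sumr// fluxN flux0 subrr mulr0 oppr0.
Qed.

Lemma xi_le rho rho' (i : 'I_N) : admissible rho -> admissible rho' ->
  rho' 0 i <= rho 0 i -> xi rho' i <= xi rho i.
Proof.
move=> /(_ i)/andP[r1 r2] /(_ i)/andP[s1 s2] le; rewrite /Defs.xi lerD2r !cellE.
rewrite -subr_ge0; apply: le_trans (cp_slope cpU s1 le r2).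
by rewrite mulr_ge0 ?(ltW (cp_gt0 cpU))// subr_ge0.
Qed.

(** At a cell j where the new potential is maximal, no velocity points towards j.
    So rho_j does not increase, and neither does xi_j as U' is increasing. *)
Lemma xi_max_principle rho rho' C : admissible rho -> admissible rho' ->
  step rho rho' -> (forall i : 'I_N, xi rho i <= C) ->
  forall i : 'I_N, xi rho' i <= C.
Proof.
move=> ad ad' st HC i.
pose i0 : 'I_N := Ordinal N0.
have [j _ jmax] := @arg_maxP _ _ _ i0 xpredT (fun i : 'I_N => xi rho' i) isT.
apply: le_trans (jmax i isT) _; apply: le_trans (HC j); apply: xi_le => //.
rewrite -subr_le0 (step_eq j st) oppr_le0.
rewrite mulr_ge0 ?divr_ge0 ?(ltW dt0) ?(ltW d0)// subr_ge0.
(* flux at the left face <= 0 <= flux at the right face *)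
apply: (@le_trans _ _ 0).
  have [w w0 ->] := flux_sign j ad'.
  case: j jmax => -[|j] jN jmax /=.
    rewrite /Defs.velocity/=.
    by rewrite subrr mul0r oppr0 mulr0.
  rewrite mulr_ge0_le0// oppr_le0 divr_ge0 ?(ltW d0)// subr_ge0.
  exact: (jmax (Ordinal (ltnW jN))).
case: (ltnP j.+1 N) => jN; last first.
  by rewrite /Defs.flux [(j.+1 < N)%N]ltnNge jN andbF.
have [w w0 ->] := flux_sign j.+1 ad'.
rewrite mulr_ge0// oppr_ge0 mulr_le0_ge0 ?invr_ge0 ?(ltW d0)// subr_le0.
exact: (jmax (Ordinal jN)).
Qed.

Lemma xi_min_principle rho rho' C : admissible rho -> admissible rho' ->
  step rho rho' -> (forall i : 'I_N, C <= xi rho i) ->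
  forall i : 'I_N, C <= xi rho' i.
Proof.
move=> ad ad' st HC i.
pose i0 : 'I_N := Ordinal N0.
have [j _ jmin] := @arg_minP _ _ _ i0 xpredT (fun i : 'I_N => xi rho' i) isT.
apply: le_trans (jmin i isT); apply: le_trans (HC j) _; apply: xi_le => //.
rewrite -subr_ge0 (step_eq j st) oppr_ge0.
rewrite mulr_ge0_le0 ?divr_ge0 ?(ltW dt0) ?(ltW d0)// subr_le0.
(* flux at the right face <= 0 <= flux at the left face *)
apply: (@le_trans _ _ 0); last first.
  have [w w0 ->] := flux_sign j ad'.
  case: j jmin => -[|j] jN jmin /=.
    rewrite /Defs.velocity/=.
    by rewrite subrr mul0r oppr0 mulr0.
  rewrite mulr_ge0// oppr_ge0 mulr_le0_ge0 ?invr_ge0 ?(ltW d0)// subr_le0.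
  exact: (jmin (Ordinal (ltnW jN))).
case: (ltnP j.+1 N) => jN; last first.
  by rewrite /Defs.flux [(j.+1 < N)%N]ltnNge jN andbF.
have [w w0 ->] := flux_sign j.+1 ad'.
rewrite mulr_ge0_le0// oppr_le0 divr_ge0 ?(ltW d0)// subr_ge0.
exact: (jmin (Ordinal jN)).
Qed.

(** * Stationary states of the scheme *)

Lemma xi_steady C (i : 'I_N) : xi (steady_state a V U N C) i = C.
Proof. by rewrite /Defs.xi cellE mxE (inv_U'K cpU) subrK. Qed.

Lemma steady_admissible C : admissible (steady_state a V U N C).
Proof. by move=> i; rewrite mxE (inv_U'_itv cpU). Qed.

Lemma steady_flux C k : flux (steady_state a V U N C) k = 0.
Proof.
case: (boolP (0 < k < N)%N) => kN; last by rewrite /Defs.flux (negbTE kN).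
have [w _ ->] := flux_sign k (steady_admissible C).
have /andP[k0 k1] := kN.
have k2 : (k.-1 < N)%N by apply/leq_ltn_trans/k1/leq_pred.
rewrite /Defs.velocity (xi_steady C (Ordinal k1)) (xi_steady C (Ordinal k2)).
by rewrite subrr mul0r oppr0 mulr0.
Qed.

Lemma steady_step C : let r := steady_state a V U N C in step r r.
Proof. by move=> r i; rewrite !steady_flux !subrr !mul0r oppr0. Qed.

(** The fluxes of a fixed point do not depend on the face and vanish at the
    boundary, so they vanish everywhere; then so do the velocities, that is, xi
    is constant. *)
Lemma step_fixed_steady rho : admissible rho -> step rho rho ->
  exists C, rho = steady_state a V U N C.
Proof.
move=> ad st.
have F k : (k <= N)%N -> flux rho k = 0.
  elim: k => // k IH kN; have := step_eq (Ordinal kN) st.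
  rewrite subrr/= (IH (ltnW kN)) subr0 => /eqP.
  rewrite eq_sym oppr_eq0 !mulf_eq0 invr_eq0 (gt_eqF dt0) (gt_eqF d0)/=.
  by move/eqP.
have X k : (k < N)%N -> xi rho k = xi rho 0.
  elim: k => // k IH kN; rewrite -(IH (ltnW kN)).
  apply/eqP; rewrite -subr_eq0 (velocityE rho k.+1).
  by rewrite (@flux_eq0 _ k.+1)// ?mul0r ?oppr0// F// ltnW.
exists (xi rho 0); apply/rowP => i; rewrite mxE -(X i)//.
by rewrite /Defs.xi cellE addrK (U'K cpU).
Qed.

(** If xi were above C (or below C) in every cell, then so would be the densities
    relative to the steady state, and the masses would differ. *)
Lemma same_mass_xi rho C : admissible rho ->
  mass rho = discrete_mass a V U N C ->
  (exists i : 'I_N, xi rho i <= C) /\ (exists i : 'I_N, C <= xi rho i).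
Proof.
move=> ad E.
have {}E : \sum_(i < N) rho 0 i = \sum_(i < N) steady_state a V U N C 0 i.
  by move: E; rewrite /discrete_mass /mass => /(mulfI (lt0r_neq0 d0)).
have i0 : 'I_N := Ordinal N0.
split; apply: contrapT => /forallNP H.
- suff : \sum_(i < N) steady_state a V U N C 0 i < \sum_(i < N) rho 0 i.
    by rewrite E ltxx.
  apply: ltr_sum => [|i _].
    by apply/hasP; exists i0; rewrite ?mem_index_enum.
  rewrite mxE -[ltRHS](U'K cpU (ad i)) (inv_U'_lt cpU)//.
  by have /negP := H i; rewrite -ltNge /Defs.xi cellE; lra.
- suff : \sum_(i < N) rho 0 i < \sum_(i < N) steady_state a V U N C 0 i.
    by rewrite E ltxx.
  apply: ltr_sum => [|i _].
    by apply/hasP; exists i0; rewrite ?mem_index_enum.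
  rewrite mxE -[ltLHS](U'K cpU (ad i)) (inv_U'_lt cpU)//.
  by have /negP := H i; rewrite -ltNge /Defs.xi cellE; lra.
Qed.

Lemma steady_state_charact rho C : admissible rho -> step rho rho ->
  mass rho = discrete_mass a V U N C -> rho = steady_state a V U N C.
Proof.
move=> ad st; have [C' ->] := step_fixed_steady ad st => E.
have [[i +] [j]] := same_mass_xi (steady_admissible C') E.
by rewrite !xi_steady => C1 C2; congr steady_state; apply/le_anti; rewrite C1.
Qed.

(** * Energy dissipation *)

Lemma convex_tangent s t : 0 < s < a -> 0 < t < a ->
  U^`() s * (t - s) <= U t - U s.
Proof.
have mono x y : 0 < x -> x < y -> y < a -> U^`() x <= U^`() y.
  move=> x0 xy ya; rewrite -subr_ge0.
  apply: le_trans (cp_slope cpU x0 (ltW xy) ya).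
  by rewrite mulr_ge0 ?(ltW (cp_gt0 cpU))// subr_ge0 ltW.
move=> /andP[s0 sa] /andP[t0 ta]; case: (ltgtP s t) => [st|ts|->].
- have [x /andP[sx xt] ->] := mvt_open U_der s0 st ta.
  by rewrite ler_wpM2r ?subr_ge0 ?(ltW st)// mono//; lra.
- have [x /andP[tx xs] E] := mvt_open U_der t0 ts sa.
  rewrite -lerN2 opprB E -mulrN opprB.
  by rewrite ler_wpM2r ?subr_ge0 ?(ltW ts)// mono//; lra.
- by rewrite !subrr mulr0.
Qed.

Definition energy rho : R :=
  \sum_(i < N) (U (rho 0 i) + V (xmid N i) * rho 0 i).

Lemma energy_tangent rho rho' : admissible rho -> admissible rho' ->
  \sum_(i < N) xi rho i * (rho' 0 i - rho 0 i) <= energy rho' - energy rho.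
Proof.
move=> ad ad'; rewrite -sumrB; apply: ler_sum => i _.
have := convex_tangent (ad i) (ad' i).
by rewrite /Defs.xi cellE => H; rewrite mulrDl; lra.
Qed.

(** Convexity of the energy makes the implicit step dissipative for every dt: the
    drop is at least the one predicted by the gradient xi at the new state. *)
Lemma energy_dissipation rho rho' : admissible rho -> admissible rho' ->
  step rho rho' ->
  dt * \sum_(k < N) flux rho' k * velocity rho' k <= energy rho - energy rho'.
Proof.
move=> ad ad' st; apply: le_trans (energy_tangent ad' ad).
have -> : \sum_(i < N) xi rho' i * (rho 0 i - rho' 0 i) =
    dt / dx N * \sum_(i < N) xi rho' i * (flux rho' i.+1 - flux rho' i).
  rewrite mulr_sumr; apply: eq_bigr => i _.
  by rewrite -opprB (step_eq i st); ring.
(* Summation by parts: the boundary terms vanish with the boundary fluxes. *)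
have E : \sum_(i < N) (xi rho' i * (flux rho' i.+1 - flux rho' i) -
    dx N * (flux rho' i * velocity rho' i)) = 0.
  pose G i := xi rho' i.-1 * flux rho' i.
  transitivity (\sum_(0 <= i < N) (G i.+1 - G i)).
    rewrite big_mkord; apply: eq_bigr => i _.
    rewrite /G/= -[xi rho' i.-1](subrK (xi rho' i)) -opprB velocityE; ring.
  by rewrite telescope_sumr// /G fluxN flux0 !mulr0 subrr.
move/eqP: E; rewrite sumrB subr_eq0 => /eqP ->.
by rewrite -mulr_sumr mulrA divfK ?gt_eqF.
Qed.

(** The gradient of the energy at the steady state is constant, hence orthogonal
    to variations that preserve the mass. *)
Lemma energy_min rho C : admissible rho -> mass rho = discrete_mass a V U N C ->
  energy (steady_state a V U N C) <= energy rho.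
Proof.
move=> ad /(mulfI (lt0r_neq0 d0)) E.
rewrite -subr_ge0; apply: le_trans (energy_tangent (steady_admissible C) ad).
under eq_bigr do rewrite xi_steady.
by rewrite -mulr_sumr sumrB E subrr mulr0.
Qed.

(** By summing velocities, which are difference quotients, each xi_i is within h
    of the potential of the first cell, as N dx = 1; and C lies between two of
    the xi_i. *)
Lemma xi_close rho C h : 0 <= h -> admissible rho ->
  mass rho = discrete_mass a V U N C ->
  (forall k, (0 < k < N)%N -> `|velocity rho k| <= h) ->
  forall i : 'I_N, `|xi rho i - C| <= 2 * h.
Proof.
move=> h0 ad E H.
have X k : (k < N)%N -> `|xi rho k - xi rho 0| <= k%:R * dx N * h.
  elim: k => [|k IH] kN; first by rewrite subrr normr0 !mul0r.
  have -> : xi rho k.+1 - xi rho 0 =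
      xi rho k - xi rho 0 - velocity rho k.+1 * dx N.
    by rewrite -[- (_ * _)](velocityE rho k.+1)/=; ring.
  apply: le_trans (ler_normB _ _) _; rewrite -[k.+1%:R]natr1 !mulrDl mul1r.
  apply: lerD; first exact/IH/ltnW.
  by rewrite normrM (gtr0_norm d0) mulrC ler_pM2l// H.
have Y (i : 'I_N) : `|xi rho i - xi rho 0| <= h.
  by apply: le_trans (X _ (ltn_ord i)) _; rewrite ler_piMl// dx_le1// ltnW.
have [[i iC] [j Cj]] := same_mass_xi ad E => k.
move: (Y i) (Y j) (Y k); rewrite !ler_norml; lra.
Qed.

(** * Convergence to the steady state *)

Lemma mass_trajectory (r : nat -> 'rV[R]_N) n :
  (forall n, step (r n) (r n.+1)) -> mass (r n) = mass (r 0).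
Proof. by move=> st; elim: n => // n <-; exact: mass_step. Qed.

(** The potentials remain in their initial range, so the densities remain between
    two values of phi. *)
Lemma trajectory_confined (r : nat -> 'rV[R]_N) :
  (forall i : 'I_N, `|V (xmid N i)| <= B) ->
  (forall n, admissible (r n)) -> (forall n, step (r n) (r n.+1)) ->
  exists p q, [/\ 0 < p, q < a &
    forall n (i : 'I_N), p <= r n 0 i <= q].
Proof.
move=> VB ad st; pose i0 : 'I_N := Ordinal N0.
have [j _ jmin] := @arg_minP _ _ _ i0 xpredT (fun i : 'I_N => xi (r 0) i) isT.
have [k _ kmax] := @arg_maxP _ _ _ i0 xpredT (fun i : 'I_N => xi (r 0) i) isT.
have lo n (i : 'I_N) : xi (r 0) j <= xi (r n) i.
  elim: n i => [i|n IH]; first exact: jmin.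
  exact: (xi_min_principle (ad n) (ad n.+1)).
have hi n (i : 'I_N) : xi (r n) i <= xi (r 0) k.
  elim: n i => [i|n IH]; first exact: kmax.
  exact: (xi_max_principle (ad n) (ad n.+1)).
exists (phi (xi (r 0) j - B)), (phi (xi (r 0) k + B)).
split; [by have /andP[] := inv_U'_itv cpU (xi (r 0) j - B)|
  by have /andP[] := inv_U'_itv cpU (xi (r 0) k + B)|move=> n i].
have := VB i; rewrite ler_norml => /andP[B1 B2].
have xiE : xi (r n) i = U^`() (r n 0 i) + V (xmid N i).
  by rewrite /Defs.xi cellE.
have := lo n i; have := hi n i; rewrite xiE => h l.
rewrite -(U'K cpU (ad n i)).
by rewrite !(inv_U'_le cpU)//; lra.
Qed.

Lemma energy_drop_cvg0 (r : nat -> 'rV[R]_N) C :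
  (forall n, admissible (r n)) -> (forall n, step (r n) (r n.+1)) ->
  mass (r 0) = discrete_mass a V U N C ->
  energy (r n) - energy (r n.+1) @[n --> \oo] --> 0.
Proof.
move=> ad st E.
have cvE : cvgn (fun n => energy (r n)).
  apply: nonincreasing_is_cvgn.
    apply/nonincreasing_seqP => n; rewrite -subr_ge0.
    apply: le_trans (energy_dissipation (ad n) (ad n.+1) (st n)).
    rewrite mulr_ge0 ?(ltW dt0)// sumr_ge0// => k _.
    have [w w0 ->] := flux_sign k (ad n.+1).
    by rewrite -mulrA -expr2 mulr_ge0// sqr_ge0.
  exists (energy (steady_state a V U N C)) => _ [n _ <-].
  by apply: energy_min => //; rewrite mass_trajectory.
rewrite -(subrr (limn (fun n => energy (r n)))).
by apply: cvgB => //; rewrite (cvg_shiftS (fun n => energy (r n))).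
Qed.

Lemma trajectory_cvg (r : nat -> 'rV[R]_N) C :
  (forall i : 'I_N, `|V (xmid N i)| <= B) ->
  (forall n, admissible (r n)) -> (forall n, step (r n) (r n.+1)) ->
  mass (r 0) = discrete_mass a V U N C ->
  r n @[n --> \oo] --> steady_state a V U N C.
Proof.
move=> VB ad st E.
have [p [q [p0 qa pq]]] := trajectory_confined VB ad st.
have pq' : p <= q by have /andP[] := pq 0%N (Ordinal N0); exact: le_trans.
have w0 : 0 < m1 p * m2 q by rewrite mulr_gt0 ?m1_gt0 ?m2_gt0//; lra.
rewrite -(cvg_shiftS r); apply/cvg_ballP => e e0.
(* phi has Lipschitz constant 1 / c and xi is within 2 * h of C, so the distance
   between the densities is at most 2 * h / c = e / 2. *)
pose h := c * e / 4.
have h0 : 0 < h by rewrite divr_gt0// mulr_gt0 ?(cp_gt0 cpU).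
have d1 : 0 < dt * (m1 p * m2 q * h ^+ 2).
  by rewrite mulr_gt0// mulr_gt0// exprn_gt0.
have /cvgr_lt /(_ _ d1) := energy_drop_cvg0 ad st E.
apply: filterS => n Hn.
have vh k : (0 < k < N)%N -> `|velocity (r n.+1) k| <= h.
  move=> kN; have /andP[_ k1] := kN.
  have S : m1 p * m2 q * velocity (r n.+1) k ^+ 2 <=
      \sum_(k < N) flux (r n.+1) k * velocity (r n.+1) k.
    apply: le_trans (flux_velocity kN p0 qa (pq n.+1)) _.
    rewrite (bigD1 (Ordinal k1))//= lerDl sumr_ge0// => l _.
    have [w w1 ->] := flux_sign l (ad n.+1).
    by rewrite -mulrA -expr2 mulr_ge0// sqr_ge0.
  have := le_lt_trans (energy_dissipation (ad n) (ad n.+1) (st n)) Hn.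
  rewrite ltr_pM2l// => /(le_lt_trans S).
  rewrite ltr_pM2l// => /ltW; rewrite -(real_normK (num_real (velocity _ _))).
  by rewrite ler_pXn2r// nnegrE// ltW.
have En : mass (r n.+1) = discrete_mass a V U N C by rewrite mass_trajectory.
split=> // i j; rewrite [i]ord1 {i} /ball/= mxE.
rewrite -[r n.+1 0 j](U'K cpU (ad n.+1 j)).
apply: le_lt_trans (inv_U'_lip_norm cpU _ _) _.
have := xi_close (ltW h0) (ad n.+1) En vh j.
rewrite /Defs.xi cellE => H.
rewrite mulrC ltr_pdivrMr ?(cp_gt0 cpU)//.
have -> : C - V (xmid N j) - U^`() (r n.+1 0 j) =
   - (U^`() (r n.+1 0 j) + V (xmid N j) - C) by ring.
rewrite normrN; apply: le_lt_trans H _; rewrite /h.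
have : 0 < c * e by rewrite mulr_gt0 ?(cp_gt0 cpU).
lra.
Qed.

Lemma attractor (J : 'rV[R]_N -> 'rV[R]_N) C :
  (forall i : 'I_N, `|V (xmid N i)| <= B) ->
  solution_map a V U m1 m2 dt J -> discrete_mass a V U N C = M ->
  let rho_oo := steady_state a V U N C in
  (forall rho, [/\ admissible rho, mass rho = M & J rho = rho] <-> rho = rho_oo)
  /\
  (forall rho0, admissible rho0 -> mass rho0 = M ->
     iter n J rho0 @[n --> \oo] --> rho_oo).
Proof.
move=> VB HJ E rho_oo; split=> [rho|rho0 ad0 E0].
  split=> [[ad Er]|->].
    move=> /(HJ rho rho ad)[_ st]; apply: steady_state_charact => //.
    by rewrite Er.
  split=> //; first exact: steady_admissible.
  have ad := steady_admissible C.
  by apply/(HJ _ _ ad); split=> //; exact: steady_step.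
have adJ rho : admissible rho -> admissible (J rho).
  by move=> ad; have [_ /(_ erefl)[]] := HJ rho (J rho) ad.
have stJ rho : admissible rho -> step rho (J rho).
  by move=> ad; have [_ /(_ erefl)[]] := HJ rho (J rho) ad.
have ad n : admissible (iter n J rho0) by elim: n => //= n /adJ.
by apply: trajectory_cvg => // [n|]; [exact: stJ|rewrite E0 E].
Qed.

End Scheme.

(** * The regularised potential *)

Section DerivativeOfPhi.
Context {R : realType}.
Local Notation mu := (@lebesgue_measure R).

Lemma ge0_subset_Rintegral (A B : set R) (f : R -> R) :
  measurable (A : set (measurableTypeR R)) ->
  measurable (B : set (measurableTypeR R)) ->
  mu.-integrable B (EFin \o f) -> (forall x, B x -> 0 <= f x) ->
  A `<=` B -> \int[mu]_(x in A) f x <= \int[mu]_(x in B) f x.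
Proof.
move=> mA mB If f0 AB; have IA := integrableS mB mA AB If.
apply: fine_le; [exact: integrable_fin_num|exact: integrable_fin_num|].
apply: ge0_subset_integral => //; first exact: measurable_int If.
Qed.

(** Phi is nondecreasing, as the oriented integral of a nonnegative function. *)
Lemma derive1_Phi_ge0 (a s0 s : R) (m U : R -> R) :
  mu.-integrable `]0, a[ (EFin \o (fun s => m s * U^`(2) s)) ->
  (forall s, 0 < s < a -> 0 <= m s * U^`(2) s) ->
  0 < s0 < a -> 0 < s < a -> 0 <= (Phi s0 m U)^`() s.
Proof.
move=> If f0 s0a sa.
pose f s := m s * U^`(2) s.
have le_int p q p' q' : 0 <= p -> q <= a -> p <= p' -> q' <= q ->
    \int[mu]_(x in `]p', q'[) f x <= \int[mu]_(x in `]p, q[) f x.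
  move=> p0 qa pp qq; apply: ge0_subset_Rintegral => //.
  - apply: integrableS If => //; apply: subset_itv; rewrite bnd_simp//.
  - by move=> x /=; rewrite in_itv/= => ?; apply: f0; lra.
  - by apply: subset_itv; rewrite bnd_simp.
have mono x y : 0 < x -> x <= y -> y < a -> Phi s0 m U x <= Phi s0 m U y.
  by move=> x0 xy ya; apply: lerB; apply: le_int; lra.
have /andP[s1 s2] := sa.
rewrite /derive1; set q := (X in lim (X @ _)).
(* Where the difference quotients diverge, the derivative has the default value
   0. *)
have [cq|/dvgP ->//] := pselect (cvg (q @ 0^')).
apply: limr_ge => //.
have e0 : 0 < Num.min s (a - s) by rewrite lt_min s1 subr_gt0.
near=> h.
have : `|h| < Num.min s (a - s).
  by near: h; apply: dnbhs0_lt.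
rewrite lt_min !ltr_norml => /andP[/andP[h1 h2] /andP[h3 h4]].
rewrite /q; case: (ltgtP h 0) => h0.
- rewrite /GRing.scale/= -mulrNN -invrN opprB.
  rewrite mulr_ge0 ?invr_ge0 ?oppr_ge0 ?(ltW h0)//.
  by rewrite subr_ge0 mono//; lra.
- rewrite /GRing.scale/= mulr_ge0 ?invr_ge0 ?(ltW h0)// subr_ge0 mono//; lra.
- by rewrite h0 invr0 scale0r.
Unshelve. all: by end_near. Qed.
End DerivativeOfPhi.

Section Regularised.
Context {R : realType} {alpha s0 e : R} {m V U kappa : R -> R}.
Context {Phi_ m_ U_ : R -> R -> R}.
Hypothesis Hst : standing_assumptions alpha s0 m V U.
Hypothesis Hrg : regularisation alpha s0 m U kappa Phi_ m_ U_.
Hypothesis He : 0 < e <= 1.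

Lemma Phi_reg_ge s : 0 < s < alpha -> e <= (Phi_ e)^`() s.
Proof.
move=> sa; have /andP[+ _] := rg_Phi_bounds Hrg He sa; apply: le_trans.
rewrite /g_trunc lerDr le_min invr_ge0 (ltW (rg_kappa_gt0 Hrg He)) andbT.
apply: derive1_Phi_ge0 (st_mU_L1 Hst) _ (st_s0 Hst) sa => t ta.
by rewrite mulr_ge0 ?(st_U_convex Hst)// ltW// (st_m_gt0 Hst).
Qed.

(** The mobility m_e is Lipschitz up to the boundary and vanishes there, so it is
    at most L * s and L * (alpha - s), while Phi_e' >= e: hence the lower bounds
    on U_e'' = Phi_e' / m_e by multiples of 1 / s and 1 / (alpha - s). *)
Lemma U_reg_coercive : exists c, coercive_potential alpha (U_ e)^`() c.
Proof.
have a0 := st_alpha Hst; have /andP[e0 e1] := He.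
have [L L0 mL] := Ck_cc_lipschitz (ltn0Sn 0) a0 (rg_m_C1 Hrg He).
have CU := (rg_U_C31 Hrg He).1.
exists (e / L / alpha); apply: coercive_of_derive; rewrite ?divr_gt0//.
- by move=> s /CU[/(_ 1%N isT)].
- by move=> s /CU[_ /(_ 2 isT)].
move=> s sa; have /andP[s1 s2] := sa.
have ms := rg_m_gt0 Hrg He sa.
have m0 : m_ e s <= L * s.
  have := mL s 0; rewrite (rg_m_0 Hrg He) !subr0 (gtr0_norm ms) (gtr0_norm s1).
  by apply; lra.
have ma : m_ e s <= L * (alpha - s).
  have := mL s alpha; rewrite (rg_m_alpha Hrg He) subr0 (gtr0_norm ms) distrC.
  by rewrite gtr0_norm ?subr_gt0//; apply; lra.
have -> : ((U_ e)^`())^`() s = (Phi_ e)^`() s / m_ e s.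
  by rewrite -(rg_U_second Hrg He sa).
have P := Phi_reg_ge sa.
have H d : 0 < d -> m_ e s <= L * d -> e / L <= d * ((Phi_ e)^`() s / m_ e s).
  move=> d0 md; rewrite ler_pdivrMr// mulrA [_ / _ * L]mulrAC ler_pdivlMr//.
  apply: le_trans (ler_wpM2l (ltW e0) md) _.
  have : 0 <= L * d * ((Phi_ e)^`() s - e).
    by rewrite mulr_ge0 ?subr_ge0// mulr_ge0// ltW.
  lra.
by split; apply: H; rewrite ?subr_gt0.
Qed.

End Regularised.

Lemma mobility_factors_gt0 {R : realType} {alpha s0 e s : R} {m U kappa : R -> R}
    {Phi_ m_ U_ m1_ m2_ : R -> R -> R} :
  regularisation alpha s0 m U kappa Phi_ m_ U_ ->
  mobility_decomposition alpha m_ m1_ m2_ ->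
  0 < e <= 1 -> 0 < s < alpha -> 0 < m1_ e s /\ 0 < m2_ e s.
Proof.
move=> Hrg Hmd He sa; have sa' : 0 <= s <= alpha by lra.
have := rg_m_gt0 Hrg He sa; rewrite (md_mul Hmd He sa').
have := md_ge0_1 Hmd He sa'; have := md_ge0_2 Hmd He sa'.
rewrite !le0r => /predU1P[->|m20]; first by rewrite mulr0 ltxx.
by move=> /predU1P[->|m10 _]; [rewrite mul0r ltxx|split].
Qed.

Unset Implicit Arguments.

Theorem theorem2p15 (R : realType) (alpha s0 : R) (m V U : R -> R)
    (kappa : R -> R) (Phi_ m_ U_ m1_ m2_ : R -> R -> R)
    (Hst : standing_assumptions alpha s0 m V U)
    (Hrg : regularisation alpha s0 m U kappa Phi_ m_ U_)
    (Hmd : mobility_decomposition alpha m_ m1_ m2_)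
    (e M : R) (He : 0 < e <= 1) (HM : 0 < M < alpha) :
  [/\ forall N : nat, (0 < N)%N ->
        exists! CD : R, discrete_mass alpha V (U_ e) N CD = M,
      forall (N : nat) (dt : R) (J : 'rV[R]_N -> 'rV[R]_N) (CD : R),
        (0 < N)%N -> 0 < dt ->
        solution_map alpha V (U_ e) (m1_ e) (m2_ e) dt J ->
        discrete_mass alpha V (U_ e) N CD = M ->
        let rho_oo := steady_state alpha V (U_ e) N CD in
        (forall rho : 'rV[R]_N,
           [/\ admissible alpha rho, mass rho = M & J rho = rho] <->
           rho = rho_oo) /\
        (forall rho0 : 'rV[R]_N, admissible alpha rho0 -> mass rho0 = M ->
           iter n J rho0 @[n --> \oo] --> rho_oo),
      exists! C : R, continuous_mass alpha V (U_ e) C = M &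
      exists K : R, forall (N : nat) (CD C : R), (0 < N)%N ->
        discrete_mass alpha V (U_ e) N CD = M ->
        continuous_mass alpha V (U_ e) C = M ->
        `|CD - C| <= K * dx N].
Proof.
have [c cpU] := U_reg_coercive Hst Hrg He.
have [L L0 VL] := Ck_cc_lipschitz (ltn0Sn 1) ltr01 (st_V_C2 Hst).
have VB x : 0 < x < 1 -> `|V x| <= `|V 0| + L.
  move=> x01; rewrite -[V x](subrK (V 0)) addrC.
  apply: le_trans (ler_normD _ _) _; rewrite lerD2l.
  apply: le_trans (VL x 0 _ _) _; [lra|lra|].
  by rewrite subr0 ger0_norm ?ler_piMr//; lra.
split.
- move=> N N0; apply: (mean_root cpU VB _ HM).
  exact: discrete_mass_mean.
- move=> N dt J CD N0 dt0 HJ HC.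
  have in_cc s : 0 < s < alpha -> s \in `[0, alpha] by rewrite in_itv/=; lra.
  have VBi (i : 'I_N) := VB _ (xmid_itv (ltn_ord i)).
  apply: (attractor cpU _ _ _ _ _ N0 dt0 VBi HJ HC).
  + by move=> s /(rg_U_C31 Hrg He).1[/(_ 0%N isT)].
  + by move=> s /(mobility_factors_gt0 Hrg Hmd He)[].
  + by move=> s /(mobility_factors_gt0 Hrg Hmd He)[].
  + by move=> s t s1 st ta; apply: (md_mono_1 Hmd He) => //; apply: in_cc; lra.
  + by move=> s t s1 st ta; apply: (md_mono_2 Hmd He) => //; apply: in_cc; lra.
- apply: (mean_root cpU VB _ HM).
  exact: (continuous_mass_mean cpU VL).
- exact: (mass_constants_close cpU VL HM VB).
Qed.
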